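(* Let $G$ be a finite simple connected graph with at least two vertices. Then $o(G\circ P_{2\ell})=o(G\circ C_{2\ell})=\mathcal{R}$ for every $\ell\ge 3$. Moreover, $R_{\rm MB}(G\circ P_6)=R_{\rm MB}'(G\circ P_6)=3n(G)$.
   Context: $P_n$ and $C_n$ are the path and cycle on $n$ vertices; $n(G)$ is the number of vertices of $G$. The lexicographic product $G\circ H$ has vertex set $V(G)\times V(H)$, with $(g,h)(g',h')$ an edge iff $gg'\in E(G)$, or $g=g'$ and $hh'\in E(H)$. A set $W\subseteq V(X)$ is a resolving set of a connected graph $X$ if for every two distinct vertices $x,y$ there is $z\in W$ with $d(x,z)\ne d(y,z)$. In the Maker-Breaker resolving game on $X$, Resolver and Spoiler alternately select unplayed vertices of $X$; Resolver wins if the vertices he selects contain a resolving set of $X$, and Spoiler wins if she selects at least one vertex of every resolving set of $X$. The R-game has Resolver moving first; the S-game has Spoiler moving first. $o(X)=\mathcal{R}$ means Resolver has a winning strategy no matter who starts. $R_{\rm MB}(X)$ (resp. $R_{\rm MB}'(X)$) is the minimum number of moves Resolver needs to win the R-game (resp. S-game) under optimal play of both players. *)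

(* Defs.v *)
From mathcomp Require Import all_boot.

Set Implicit Arguments.
Unset Strict Implicit.
Unset Printing Implicit Defensive.

(* A graph on the finite vertex set T is its adjacency relation e : rel T. *)

Definition simple_graph (T : finType) (e : rel T) : Prop :=
  symmetric e /\ irreflexive e.

Definition connected_graph (T : finType) (e : rel T) : Prop :=
  forall x y : T, connect e x y.

Definition path_graph (n : nat) : rel 'I_n :=
  fun i j => (i.+1 == j :> nat) || (j.+1 == i :> nat).
Arguments path_graph : clear implicits.

(* [ordS] is the cyclic successor, so this is the n-cycle for n >= 3. *)
Definition cycle_graph (n : nat) : rel 'I_n :=
  fun i j => (ordS i == j) || (ordS j == i).
Arguments cycle_graph : clear implicits.

Definition lex_product (V U : finType) (e : rel V) (f : rel U) : rel (V * U) :=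
  fun x y => e x.1 y.1 || ((x.1 == y.1) && f x.2 y.2).

Definition has_walk (T : finType) (e : rel T) (x y : T) (n : nat) : bool :=
  [exists p : n.-tuple T, path e x p && (last x p == y)].

(* The least length of a walk from x to y.  Shortest walks have length less
   than #|T|; the value is #|T| when y is not reachable from x. *)
Definition dist (T : finType) (e : rel T) (x y : T) : nat :=
  find (has_walk e x y) (iota 0 #|T|).

Definition resolving (T : finType) (e : rel T) (W : {set T}) : bool :=
  [forall x, forall y, (x != y) ==> [exists z in W, dist e x z != dist e y z]].

Definition contains_resolving (T : finType) (e : rel T) (A : {set T}) : bool :=
  [exists W : {set T}, (W \subset A) && resolving e W].

Variant player := Resolver | Spoiler.

Definition opponent (w : player) : player :=
  if w is Resolver then Spoiler else Resolver.

(* Who makes the move of index i (counted from 0) when w moves first. *)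
Definition mover (w : player) (i : nat) : player := iter i opponent w.

(* A play is the sequence, in chronological order, of the vertices selected by
   both players.  It goes on until the board is full: this does not affect who
   wins, since both winning conditions persist once they hold and exactly one
   of them holds on a full board. *)
Definition complete_play (T : finType) (p : seq T) : Prop :=
  uniq p /\ size p = #|T|.

Fixpoint resolver_moves (T : finType) (w : player) (p : seq T) : seq T :=
  if p is x :: p' then
    let r := resolver_moves (opponent w) p' in
    if w is Resolver then x :: r else r
  else [::].

(* A strategy maps the history of the play to the next vertex to select. *)
Definition strategy (T : finType) := seq T -> T.

Definition legal (T : finType) (s : strategy T) : Prop :=
  forall h : seq T, uniq h -> size h < #|T| -> s h \notin h.

Definition resolver_follows (T : finType) (w : player) (s : strategy T)
    (p : seq T) : Prop :=
  forall (h : seq T) (x : T),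
    prefix (rcons h x) p -> mover w (size h) = Resolver -> x = s h.

Definition resolver_winning_strategy (T : finType) (e : rel T) (w : player)
    (s : strategy T) : Prop :=
  legal s /\
  forall p : seq T, complete_play p -> resolver_follows w s p ->
    contains_resolving e [set x in resolver_moves w p].

(* o(X) = R *)
Definition outcome_R (T : finType) (e : rel T) : Prop :=
  forall w : player, exists s : strategy T, resolver_winning_strategy e w s.

(* Playing s, Resolver has always won after at most k moves of his own. *)
Definition wins_within (T : finType) (e : rel T) (w : player)
    (s : strategy T) (k : nat) : Prop :=
  legal s /\
  forall p : seq T, complete_play p -> resolver_follows w s p ->
    contains_resolving e [set x in take k (resolver_moves w p)].

Definition is_min (P : nat -> Prop) (k : nat) : Prop :=
  P k /\ forall j : nat, P j -> k <= j.

(* [is_game_length e w k]: under optimal play, k is the number of moves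
   Resolver needs to win the game in which w moves first.  It holds for no k
   when Resolver has no winning strategy. *)
Definition is_game_length (T : finType) (e : rel T) (w : player) (k : nat)
    : Prop :=
  is_min (fun j => exists s : strategy T, wins_within e w s j) k.

(* R_MB(X) = k *)
Definition R_MB_is (T : finType) (e : rel T) (k : nat) : Prop :=
  is_game_length e Resolver k.

(* R'_MB(X) = k *)
Definition R_MB'_is (T : finType) (e : rel T) (k : nat) : Prop :=
  is_game_length e Spoiler k.

(* Main.v *)
Require Import Defs.
From mathcomp Require Import all_boot zify.

(* Split H = P_2l or C_2l into the edges {2i, 2i+1}.  Any set meeting every copy
   of these edges in every layer of G o H resolves G o H: in each layer it is
   dominating, it is contained in no neighborhood, and it tells apart the
   vertices of the layer since H has no 4-cycle.  Resolver wins by the pairing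
   strategy on these edges.  In a layer P_6 = 0-1-2-3-4-5 the only pairs that
   tell its vertices apart are {1, 3} and {2, 4}, so by playing the pairing
   strategy on {1, 3}, {2, 4}, {0, 5} Spoiler forces Resolver to select three
   vertices in each layer; three per layer is all that Resolver ever gets. *)

Set Implicit Arguments.
Unset Strict Implicit.
Unset Printing Implicit Defensive.

Section Distance.

Variables (T : finType) (e : rel T).
Implicit Types x y z : T.

Lemma has_walk0 x y : has_walk e x y 0 = (x == y).
Proof.
apply/existsP/idP => [[p]|xy]; first by rewrite tuple0.
by exists [tuple].
Qed.

Lemma has_walkSP x y n :
  reflect (exists2 z, e x z & has_walk e z y n) (has_walk e x y n.+1).
Proof.
apply: (iffP existsP) => [[p]|[z exz /existsP[p /andP[pP yP]]]].
  case/tupleP: p => z p /=; rewrite -andbA => /and3P[exz pP yP].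
  by exists z => //; apply/existsP; exists p; rewrite pP.
by exists [tuple of z :: p]; rewrite /= exz pP.
Qed.

Lemma has_walk1 x y : has_walk e x y 1 = e x y.
Proof.
apply/has_walkSP/idP => [[z exz]|exy]; first by rewrite has_walk0 => /eqP <-.
by exists y; rewrite ?has_walk0.
Qed.

Lemma dist_le_card x y : dist e x y <= #|T|.
Proof. by rewrite -[X in _ <= X](size_iota 0) find_size. Qed.

Lemma dist_le_walk x y n : has_walk e x y n -> dist e x y <= n.
Proof.
rewrite leqNgt; apply: contraL => lt_n; have := before_find 0 lt_n.
by rewrite nth_iota ?(leq_trans lt_n) ?dist_le_card // add0n => ->.
Qed.

Lemma has_walk_dist x y : dist e x y < #|T| -> has_walk e x y (dist e x y).
Proof.
move=> ltT; have := ltT; rewrite -[X in _ < X](size_iota 0) -has_find.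
by move/(nth_find 0); rewrite nth_iota.
Qed.

Lemma leq_dist_walks x y z :
  (forall n, has_walk e x z n -> exists2 m, m <= n & has_walk e y z m) ->
  dist e y z <= dist e x z.
Proof.
move=> shorter; have [ltT|] := ltnP (dist e x z) #|T|; last first.
  exact/leq_trans/dist_le_card.
have [m le_m walk_m] := shorter _ (has_walk_dist ltT).
exact: leq_trans (dist_le_walk walk_m) le_m.
Qed.

Lemma dist_eq0 x y : (dist e x y == 0) = (x == y).
Proof.
apply/eqP/idP => [d0|]; last first.
  by rewrite -has_walk0 => /dist_le_walk; rewrite leqn0 => /eqP.
rewrite -has_walk0 -[X in has_walk _ _ _ X]d0 has_walk_dist // d0.
by apply/card_gt0P; exists x.
Qed.

Hypothesis e_irr : irreflexive e.

Lemma dist_eq1 x y : (dist e x y == 1) = e x y.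
Proof.
apply/eqP/idP => [d1|exy].
  rewrite -has_walk1 -[X in has_walk _ _ _ X]d1 has_walk_dist // d1.
  by apply/card_gt1P; exists x, y; rewrite -dist_eq0 d1.
have nxy : x != y by apply: contraTneq exy => ->; rewrite e_irr.
apply/eqP; rewrite eqn_leq lt0n dist_eq0 nxy andbT.
by rewrite dist_le_walk ?has_walk1.
Qed.

Lemma dist_eq2 x y z :
  x != y -> ~~ e x y -> e x z -> e z y -> dist e x y = 2.
Proof.
rewrite -dist_eq0 -dist_eq1 => d_neq0 d_neq1 exz ezy.
have : dist e x y <= 2.
  by apply/dist_le_walk/has_walkSP; exists z; rewrite ?has_walk1.
by case: dist d_neq0 d_neq1 => [|[|[|]]].
Qed.

End Distance.

(* Resolving by the distance truncated at 2, the only information that a vertex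
   of a layer provides about the other vertices of its layer. *)
Definition adj_resolves (T : eqType) (e : rel T) (z x y : T) : bool :=
  ((x == z) != (y == z)) || (e x z != e y z).

Section Resolving.

Variables (T : finType) (e : rel T).
Implicit Types (x y z : T) (A W : {set T}).

Definition resolves z x y : bool := dist e x z != dist e y z.

Lemma resolvingP W :
  reflect (forall x y, x != y -> exists2 z, z \in W & resolves z x y)
          (resolving e W).
Proof.
apply: (iffP 'forall_forallP) => resW x y => [nxy|].
  by have /implyP/(_ nxy)/exists_inP := resW x y.
by apply/implyP => /resW/exists_inP.
Qed.

Lemma contains_resolvingE A : contains_resolving e A = resolving e A.
Proof.
apply/existsP/idP => [[W /andP[/subsetP sWA /resolvingP resW]]|resA].
  by apply/resolvingP => x y /resW[z /sWA]; exists z.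
by exists A; rewrite subxx.
Qed.

Definition adj_resolving A : Prop :=
  forall x y, x != y -> exists2 z, z \in A & adj_resolves e z x y.

Definition dominating A : Prop :=
  forall x, exists2 z, z \in A & (x == z) || e x z.

Lemma adj_resolves_resolves z x y :
  irreflexive e -> adj_resolves e z x y -> resolves z x y.
Proof.
move=> e_irr; apply: contraTneq => eq_d.
by rewrite /adj_resolves -!(dist_eq0 e) -!(dist_eq1 e_irr) eq_d !eqxx.
Qed.

End Resolving.

Section Pairing.

Variables (T : finType) (m : T -> T).
Implicit Type A : {set T}.

Definition meets_pairs A : Prop := forall x, (x \in A) || (m x \in A).

Definition contains_no_pair A : Prop := forall x, x \in A -> m x \notin A.

End Pairing.

Section PerfectMatching.

Variables (U : finType) (f : rel U) (m : U -> U) (A : {set U}).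

Definition perfect_matching : Prop := involutive m /\ forall u, f u (m u).

Definition C4_free : Prop :=
  forall a b c d, f a b -> f b c -> f c d -> f d a -> a = c \/ b = d.

Definition pair_off_neighborhoods : Prop :=
  forall u, exists2 v, ~~ f u v & ~~ f u (m v).

Hypotheses (m_matching : perfect_matching) (A_meets : meets_pairs m A).

Lemma meets_pairs_dominating : dominating f A.
Proof.
have [_ f_m] := m_matching.
by move=> u; case/orP: (A_meets u) => Au; [exists u | exists (m u)];
  rewrite ?eqxx ?f_m ?orbT.
Qed.

Lemma meets_pairs_not_subset_neighborhood u :
  pair_off_neighborhoods -> ~~ (A \subset f u).
Proof.
move=> /(_ u)[v nfv nfmv]; apply/subsetPn.
by case/orP: (A_meets v) => Av; [exists v | exists (m v)].
Qed.

(* Two vertices outside A that are not told apart by their mates form a 4-cycle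
   with them. *)
Lemma meets_pairs_adj_resolving :
  symmetric f -> C4_free -> adj_resolving f A.
Proof.
have [mK f_m] := m_matching; move=> f_sym f_C4 u v nuv.
have [Au|nAu] := boolP (u \in A).
  by exists u; rewrite // /adj_resolves eqxx [v == u]eq_sym (negPf nuv).
have [Av|nAv] := boolP (v \in A).
  by exists v; rewrite // /adj_resolves eqxx (negPf nuv).
have Amu : m u \in A by have := A_meets u; rewrite (negPf nAu).
have Amv : m v \in A by have := A_meets v; rewrite (negPf nAv).
have [f_v_mu|nf_v_mu] := boolP (f v (m u)); last first.
  by exists (m u); rewrite // /adj_resolves f_m (negPf nf_v_mu) orbT.
have [f_u_mv|nf_u_mv] := boolP (f u (m v)); last first.
  by exists (m v); rewrite // /adj_resolves f_m (negPf nf_u_mv) orbT.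
have := f_C4 _ _ _ _ (f_m u) _ (f_m v); rewrite f_sym f_v_mu f_sym f_u_mv.
by case=> // [uv|/(can_inj mK) uv]; rewrite uv eqxx in nuv.
Qed.

End PerfectMatching.

Section LexProduct.

Variables (V U : finType) (e : rel V) (f : rel U).
Implicit Types (g k : V) (u v a : U) (W : {set V * U}).
Local Notation lex := (lex_product e f).

Definition layer W g : {set U} := [set u | (g, u) \in W].

Lemma card_layers W : #|W| = \sum_g #|layer W g|.
Proof.
rewrite -sum1_card; under [RHS]eq_bigr do rewrite -sum1_card.
by rewrite pair_big_dep /=; apply: eq_bigl => -[g u]; rewrite inE.
Qed.

(* A walk may wander inside the starting layer; everything before it first
   leaves that layer can be cut, after which only the layer matters. *)
Lemma dist_lex_layer_le g g' u u' v :
  g != g' -> dist lex (g, u') (g', v) <= dist lex (g, u) (g', v).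
Proof.
move=> ngg'; apply: leq_dist_walks => n.
elim: n u => [|n IHn] u; first by rewrite has_walk0 xpair_eqE (negPf ngg').
case/has_walkSP => -[g1 u1]; rewrite {1}/lex_product /=.
have [<- _ /IHn[l le_l walk_l]|_] := eqVneq g g1.
  by exists l => //; apply: leqW.
rewrite orbF => eg1 walk_n; exists n.+1 => //.
by apply/has_walkSP; exists (g1, u1); rewrite //= /lex_product /= eg1.
Qed.

Lemma dist_lex_layer g g' u u' v :
  g != g' -> dist lex (g, u') (g', v) = dist lex (g, u) (g', v).
Proof. by move=> ngg'; apply/eqP; rewrite eqn_leq !dist_lex_layer_le. Qed.

Hypotheses (e_irr : irreflexive e) (f_irr : irreflexive f).

Lemma lex_product_irr : irreflexive lex.
Proof. by move=> [g u]; rewrite /lex_product /= e_irr f_irr andbF. Qed.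

Lemma lex_product_in_layer g u v : lex (g, u) (g, v) = f u v.
Proof. by rewrite /lex_product /= e_irr eqxx. Qed.

Lemma adj_resolves_in_layer g a u v :
  adj_resolves lex (g, a) (g, u) (g, v) = adj_resolves f a u v.
Proof. by rewrite /adj_resolves !lex_product_in_layer !xpair_eqE eqxx. Qed.

Lemma resolving_lex W :
  (forall g, adj_resolving f (layer W g)) ->
  (forall g, dominating f (layer W g)) ->
  (forall g u, ~~ (layer W g \subset f u)) ->
  resolving lex W.
Proof.
move=> adj_resW domW nsubW; apply/resolvingP => -[g u] [g' u'] nxy.
suff [a Wa res_a] :
    exists2 a, a \in layer W g & adj_resolves lex (g, a) (g, u) (g', u').
  rewrite inE in Wa; exists (g, a) => //.
  exact: adj_resolves_resolves lex_product_irr res_a.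
have [eg|ngg'] := eqVneq g g'.
  rewrite -{}eg xpair_eqE eqxx in nxy *.
  have [a Wa res_a] := adj_resW g u u' nxy.
  by exists a; rewrite ?adj_resolves_in_layer.
have [eg'g|neg'g] := boolP (e g' g).
  have /subsetPn[a Wa nfua] := nsubW g u; exists a => //.
  rewrite /adj_resolves lex_product_in_layer [f u a](negPf nfua).
  by rewrite /lex_product /= eg'g orbT.
have [a Wa dom_a] := domW g u; exists a => //.
rewrite /adj_resolves lex_product_in_layer !xpair_eqE eqxx [g' == g]eq_sym.
rewrite /lex_product /= (negPf neg'g) [g' == g]eq_sym (negPf ngg') /=.
by case/orP: dom_a => ->; rewrite ?orbT.
Qed.

Hypothesis e_sym : symmetric e.

Lemma dist_lex_in_layer g k u v : e g k ->
  dist lex (g, u) (g, v) = if u == v then 0 else if f u v then 1 else 2.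
Proof.
move=> egk; have [->|nuv] := eqVneq; first by apply/eqP; rewrite dist_eq0.
case: ifP => fuv.
  by apply/eqP; rewrite (dist_eq1 lex_product_irr) lex_product_in_layer.
apply: (dist_eq2 lex_product_irr (z := (k, u))).
- by rewrite xpair_eqE eqxx.
- by rewrite lex_product_in_layer fuv.
- by rewrite /lex_product /= egk.
- by rewrite /lex_product /= e_sym egk.
Qed.

Lemma resolves_in_layer g k a u v : e g k ->
  resolves lex (g, a) (g, u) (g, v) = adj_resolves f a u v.
Proof.
move=> egk; rewrite /resolves !(dist_lex_in_layer _ _ egk) /adj_resolves.
have [->|_] := eqVneq u a; have [->|_] := eqVneq v a; rewrite ?f_irr //.
- by case: (f v a).
- by case: (f u a).
- by case: (f u a); case: (f v a).
Qed.

Lemma resolving_lex_adj_resolving g k W :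
  e g k -> resolving lex W -> adj_resolving f (layer W g).
Proof.
move=> egk /resolvingP resW u v nuv.
have [|[g' a] Wa] := resW (g, u) (g, v); first by rewrite xpair_eqE eqxx.
have [eg|ngg'] := eqVneq g g'; last first.
  by rewrite /resolves (dist_lex_layer v) ?eqxx.
rewrite -{}eg in Wa *; rewrite (resolves_in_layer _ _ _ egk) => res_a.
by exists a; rewrite ?inE.
Qed.

End LexProduct.

Section Plays.

Variable T : finType.
Implicit Types (p h : seq T) (s : strategy T) (w a : player) (x : T).

Lemma opponentK : involutive opponent. Proof. by case. Qed.

Lemma moverS w i : mover w i.+1 = opponent (mover w i).
Proof. by []. Qed.

Lemma mover_opponent w i : mover (opponent w) i = mover w i.+1.
Proof. by rewrite /mover iterSr. Qed.

Definition follows a w s p : Prop :=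
  forall h x, prefix (rcons h x) p -> mover w (size h) = a -> x = s h.

Lemma complete_play_mem p x : complete_play p -> x \in p.
Proof.
case=> up size_p; apply: contraT => nx; have := max_card (mem (x :: p)).
by rewrite (card_uniqP _) /= ?nx ?up // size_p ltnn.
Qed.

Lemma resolver_movesP w p x : uniq p ->
  reflect (x \in p /\ mover w (index x p) = Resolver)
          (x \in resolver_moves w p).
Proof.
elim: p w => [w _|y p IHp w /= /andP[ny up]]; first by constructor=> -[].
have rest := IHp (opponent w) up; rewrite mover_opponent in rest.
rewrite inE; have [yx|nyx] := eqVneq y x.
  case: w {rest} => /=; first by rewrite inE yx eqxx; constructor.
  rewrite yx in ny; apply: (iffP (IHp Resolver up)) => -[] //.
  by rewrite (negPf ny).
by case: w rest => //= rest; rewrite inE eq_sym (negPf nyx).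
Qed.

Lemma size_resolver_moves w p :
  size (resolver_moves w p) =
    if w is Resolver then uphalf (size p) else (size p)./2.
Proof.
by elim: p w => [|x p IHp] [] //=; rewrite IHp // uphalf_half.
Qed.

Lemma self_play_exists s : legal s ->
  exists2 p, complete_play p & forall h x, prefix (rcons h x) p -> x = s h.
Proof.
move=> legal_s.
suff play n : n <= #|T| -> exists p, [/\ uniq p, size p = n &
    forall h x, prefix (rcons h x) p -> x = s h].
  by have [p [up sp follow_p]] := play _ (leqnn _); exists p.
elim: n => [|n IHn] ltn; first by exists [::]; split=> // -[|? ?] ?.
have [p [up size_p follow_p]] := IHn (ltnW ltn); exists (rcons p (s p)); split.
- by rewrite rcons_uniq up andbT legal_s // size_p.
- by rewrite size_rcons size_p.
move=> h x /prefixP[t]; case/lastP: t => [|t y].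
  by rewrite cats0 => /rcons_inj[-> ->].
rewrite -rcons_cat => /rcons_inj[pE _].
by apply: follow_p; rewrite pE prefix_prefix.
Qed.

Lemma play_exists w sR sS : legal sR -> legal sS ->
  exists p,
    [/\ complete_play p, follows Resolver w sR p & follows Spoiler w sS p].
Proof.
move=> legal_sR legal_sS.
pose s h := if mover w (size h) is Resolver then sR h else sS h.
have legal_s : legal s.
  move=> h uh size_h; rewrite /s.
  by case: mover; [apply: legal_sR | apply: legal_sS].
have [p complete_p follow_p] := self_play_exists legal_s.
by exists p; split=> // h x /follow_p ->; rewrite /s => ->.
Qed.

End Plays.

Section PairingStrategy.

Variables (T : finType) (x0 : T) (m : T -> T).
Implicit Types (p h : seq T) (w a : player) (x : T).

Definition pairing_strategy : strategy T := fun h =>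
  if m (last x0 h) \notin h then m (last x0 h)
  else odflt x0 [pick z | z \notin h].

Lemma pairing_strategy_legal : legal pairing_strategy.
Proof.
move=> h uh size_h; rewrite /pairing_strategy; case: ifP => // _.
case: pickP => //= all_h; suff : #|T| <= size h by rewrite leqNgt size_h.
rewrite -(card_uniqP uh); apply/subset_leq_card/subsetP => z _.
by have := all_h z; case: (z \in h).
Qed.

Lemma pairing_strategy_replies a w p x : uniq p ->
  follows a w pairing_strategy p -> mover w (index x p) = opponent a ->
  index x p < index (m x) p < size p -> index (m x) p = (index x p).+1.
Proof.
move=> up follow_p mover_x /andP[lt_x lt_mx].
have x_p : x \in p by rewrite -index_mem (ltn_trans lt_x).
have mx_p : m x \in p by rewrite -index_mem.
have lt_next : (index x p).+1 < size p := leq_ltn_trans lt_x lt_mx.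
set h := take (index x p).+1 p.
have size_h : size h = (index x p).+1 by rewrite size_takel // ltnW.
have last_h : last x0 h = x by rewrite -nth_last size_h nth_take ?nth_index.
have mx_h : m x \notin h by rewrite in_take // ltnS -ltnNge.
have := follow_p h (nth x0 p (index x p).+1); rewrite -take_nth // prefix_take.
rewrite size_h moverS mover_x opponentK => /(_ isT erefl).
by rewrite /pairing_strategy last_h mx_h => <-; rewrite index_uniq.
Qed.

Hypotheses (mK : involutive m) (m_neq : forall x, m x != x).

Lemma pairing_strategy_splits a w p x : uniq p ->
  follows a w pairing_strategy p -> x \in p -> m x \in p ->
  mover w (index x p) = opponent a -> mover w (index (m x) p) = a.
Proof.
move=> up follow_p x_p mx_p mover_x.
have [lt_x|lt_mx|/index_inj eq_x] := ltngtP (index x p) (index (m x) p).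
- rewrite (pairing_strategy_replies up follow_p) ?lt_x ?index_mem //.
  by rewrite moverS mover_x opponentK.
- have [//|mover_mx] : mover w (index (m x) p) = a \/
      mover w (index (m x) p) = opponent a by case: mover; case: (a); auto.
  have := pairing_strategy_replies up follow_p mover_mx.
  rewrite mK lt_mx index_mem x_p => /(_ isT) index_x; move: mover_x.
  by rewrite index_x moverS mover_mx; case: (a).
- by have := m_neq x; rewrite -eq_x // eqxx.
Qed.

Lemma pairing_strategy_meets_pairs w p : complete_play p ->
  follows Resolver w pairing_strategy p ->
  meets_pairs m [set x in resolver_moves w p].
Proof.
move=> complete_p follow_p x; have [up _] := complete_p; rewrite !inE.
have in_p y : y \in p := complete_play_mem y complete_p.
case mover_x: (mover w (index x p)).
  by apply/orP; left; apply/resolver_movesP.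
apply/orP; right; apply/resolver_movesP => //; split=> //.
exact: (pairing_strategy_splits up follow_p).
Qed.

Lemma pairing_strategy_contains_no_pair w p : uniq p ->
  follows Spoiler w pairing_strategy p ->
  contains_no_pair m [set x in resolver_moves w p].
Proof.
move=> up follow_p x; rewrite !inE => /(resolver_movesP _ _ up)[x_p mover_x].
apply/(resolver_movesP _ _ up) => -[mx_p].
by rewrite (pairing_strategy_splits up follow_p).
Qed.

End PairingStrategy.

Section ResolvingGame.

Variables (T : finType) (e : rel T).

Lemma winning_strategy_wins_within w (s : strategy T) :
  resolver_winning_strategy e w s -> wins_within e w s (uphalf #|T|).
Proof.
move=> [legal_s win_s]; split=> // p complete_p follow_p.
have [_ size_p] := complete_p.
rewrite take_oversize ?win_s // size_resolver_moves size_p.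
by case: (w); rewrite // uphalf_half leq_addl.
Qed.

Variables (x0 : T) (m : T -> T).
Hypotheses (mK : involutive m) (m_neq : forall x, m x != x).

Lemma pairing_outcome_R :
  (forall A : {set T}, meets_pairs m A -> resolving e A) -> outcome_R e.
Proof.
move=> m_resolving w; exists (pairing_strategy x0 m).
split=> [|p complete_p follow_p]; first exact: pairing_strategy_legal.
rewrite contains_resolvingE; apply: m_resolving.
exact: (pairing_strategy_meets_pairs mK m_neq complete_p follow_p).
Qed.

Lemma pairing_wins_within_ge w (s : strategy T) n j :
  (forall A : {set T}, contains_no_pair m A -> resolving e A -> n <= #|A|) ->
  wins_within e w s j -> n <= j.
Proof.
move=> n_le [legal_s win_s].
have [p [complete_p follow_s follow_m]] :=
  play_exists w legal_s (pairing_strategy_legal x0 m).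
have := win_s p complete_p follow_s; rewrite contains_resolvingE.
set A := [set x in _] => resA; apply: (@leq_trans #|A|).
  apply: n_le resA => x; rewrite !inE => /mem_take Rx.
  have [up _] := complete_p.
  have := pairing_strategy_contains_no_pair mK m_neq up follow_m (x := x).
  by rewrite !inE => /(_ Rx); apply: contra => /mem_take.
by rewrite cardsE (leq_trans (card_size _)) // size_take_min geq_minl.
Qed.

End ResolvingGame.

Section LexPairing.

Variables (V U : finType) (e : rel V) (f : rel U) (m : U -> U).

Definition layer_mate (x : V * U) : V * U := (x.1, m x.2).

Lemma layer_mateK : involutive m -> involutive layer_mate.
Proof. by move=> mK [g u]; rewrite /layer_mate /= mK. Qed.

Lemma layer_mate_neq : (forall u, m u != u) -> forall x, layer_mate x != x.
Proof. by move=> m_neq [g u]; rewrite xpair_eqE eqxx m_neq. Qed.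

Hypotheses (e_irr : irreflexive e) (f_irr : irreflexive f).

Lemma lex_product_outcome_R : 0 < #|{: V * U}| -> symmetric f -> C4_free f ->
  perfect_matching f m -> pair_off_neighborhoods f m ->
  outcome_R (lex_product e f).
Proof.
move=> /card_gt0P[x0 _] f_sym f_C4 m_matching m_off.
have [mK f_m] := m_matching.
have m_neq u : m u != u by apply: contraTneq (f_m u) => ->; rewrite f_irr.
apply: (pairing_outcome_R x0 (layer_mateK mK) (layer_mate_neq m_neq)).
move=> W W_meets.
have layer_meets g : meets_pairs m (layer W g).
  by move=> u; rewrite !inE; apply: W_meets.
apply: resolving_lex => // g *.
- exact: (meets_pairs_adj_resolving m_matching).
- exact: (meets_pairs_dominating m_matching).
- exact: (meets_pairs_not_subset_neighborhood (layer_meets g)).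
Qed.

Lemma resolving_lex_card n (W : {set V * U}) :
  symmetric e -> (forall g, exists k, e g k) ->
  (forall A, contains_no_pair m A -> adj_resolving f A -> n <= #|A|) ->
  contains_no_pair layer_mate W -> resolving (lex_product e f) W ->
  n * #|V| <= #|W|.
Proof.
move=> e_sym e_neighbor n_le W_no_pair resW.
rewrite card_layers mulnC -sum_nat_const; apply: leq_sum => g _; apply: n_le.
  by move=> u; rewrite !inE; apply: W_no_pair.
have [k egk] := e_neighbor g.
exact: (resolving_lex_adj_resolving e_irr f_irr e_sym egk).
Qed.

End LexPairing.

Lemma connected_neighbor (V : finType) (e : rel V) (g : V) :
  connected_graph e -> 1 < #|V| -> exists k, e g k.
Proof.
move=> e_conn V_gt1.
have [h nhg] : exists h, h != g.
  have : 0 < #|[set~ g]| by rewrite cardsC1; lia.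
  by case/card_gt0P => h; rewrite !inE => nhg; exists h.
have /connectP[[|k p] /=] := e_conn g h.
  by move=> _ hg; rewrite hg eqxx in nhg.
by case/andP => egk _ _; exists k.
Qed.

Lemma path_graph_sym n : symmetric (path_graph n).
Proof. by move=> i j; rewrite /path_graph orbC. Qed.

Lemma path_graph_irr n : irreflexive (path_graph n).
Proof. by move=> i; rewrite /path_graph; lia. Qed.

Lemma path_graph_C4_free n : C4_free (path_graph n).
Proof.
move=> a b c d; rewrite /path_graph => ab bc cd da.
have [ac|nac] := eqVneq (a : nat) c; first by left; apply: val_inj.
by right; apply: val_inj; rewrite /=; lia.
Qed.

Lemma cycle_graphE n (i j : 'I_n) : cycle_graph n i j =
  [|| i.+1 == j, j.+1 == i, (i.+1 == n) && (j == 0 :> nat)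
    | (j.+1 == n) && (i == 0 :> nat)].
Proof.
have ordSE (k k' : 'I_n) :
    (ordS k == k') = (k.+1 == k' :> nat) || (k.+1 == n) && (k' == 0 :> nat).
  rewrite -val_eqE /=; have := ltn_ord k; have := ltn_ord k'.
  have [->|nk] := eqVneq k.+1 n; first by rewrite modnn; lia.
  by move=> ? ?; rewrite modn_small; lia.
by rewrite /cycle_graph !ordSE; lia.
Qed.

Lemma cycle_graph_sym n : symmetric (cycle_graph n).
Proof. by move=> i j; rewrite /cycle_graph orbC. Qed.

Lemma cycle_graph_irr n : n != 1 -> irreflexive (cycle_graph n).
Proof. by move=> n_neq1 i; rewrite cycle_graphE; lia. Qed.

Lemma cycle_graph_C4_free n : n != 4 -> C4_free (cycle_graph n).
Proof.
move=> n_neq4 a b c d; rewrite !cycle_graphE => ab bc cd da.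
have [ac|nac] := eqVneq (a : nat) c; first by left; apply: val_inj.
by right; apply: val_inj; rewrite /=; move: ab bc cd da nac; lia.
Qed.

Lemma path_sub_cycle n : subrel (path_graph n) (cycle_graph n).
Proof. by move=> i j; rewrite cycle_graphE /path_graph; lia. Qed.

Section EvenOddPairing.

Variable l : nat.
Implicit Type i : 'I_(2 * l).

Definition even_odd_mate (i : nat) : nat := if odd i then i.-1 else i.+1.

Lemma even_odd_mate_lt i : even_odd_mate i < 2 * l.
Proof. by have := ltn_ord i; rewrite /even_odd_mate; case: ifP; lia. Qed.

Definition ord_mate i : 'I_(2 * l) := Ordinal (even_odd_mate_lt i).

Lemma path_graph_matching : perfect_matching (path_graph (2 * l)) ord_mate.
Proof.
split=> i; last by rewrite /path_graph /= /even_odd_mate; case: ifP; lia.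
apply: val_inj; rewrite /= /even_odd_mate.
by case: (boolP (odd i)) => oi; case: ifP; lia.
Qed.

Lemma cycle_graph_matching : perfect_matching (cycle_graph (2 * l)) ord_mate.
Proof.
by have [mK adj] := path_graph_matching; split=> // i; apply: path_sub_cycle.
Qed.

(* Three steps ahead of u, both the vertex and its mate are at distance at least
   2 from u. *)
Lemma cycle_graph_pair_off_neighborhoods : 2 < l ->
  pair_off_neighborhoods (cycle_graph (2 * l)) ord_mate.
Proof.
move=> l_gt2 u; have lt_u := ltn_ord u; have l2_gt0 : 0 < 2 * l by lia.
have [v vE] : exists v : 'I_(2 * l),
    v = (if u + 3 < 2 * l then u + 3 else u + 3 - 2 * l) :> nat.
  exists (Ordinal (ltn_pmod (u + 3) l2_gt0)) => /=.
  case: ltnP => [/modn_small //|wraps].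
  by rewrite -{1}(subnK wraps) modnDr modn_small; lia.
by exists v; rewrite cycle_graphE /= /even_odd_mate vE; do !case: ifP; lia.
Qed.

Lemma path_graph_pair_off_neighborhoods : 2 < l ->
  pair_off_neighborhoods (path_graph (2 * l)) ord_mate.
Proof.
move=> l_gt2 u; have [v nuv numv] := cycle_graph_pair_off_neighborhoods l_gt2 u.
by exists v; [apply: contra nuv | apply: contra numv]; apply: path_sub_cycle.
Qed.

End EvenOddPairing.

Section LexPathCycle.

Variables (V : finType) (e : rel V) (l : nat).
Hypotheses (e_irr : irreflexive e) (V_gt0 : 0 < #|V|) (l_gt2 : 2 < l).

Let lex_board_gt0 : 0 < #|{: V * 'I_(2 * l)}|.
Proof. by rewrite card_prod card_ord; lia. Qed.

Lemma lex_path_outcome_R : outcome_R (lex_product e (path_graph (2 * l))).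
Proof.
apply: (@lex_product_outcome_R _ _ _ _ (@ord_mate l)) => //.
- exact: path_graph_irr.
- exact: path_graph_sym.
- exact: path_graph_C4_free.
- exact: path_graph_matching.
- exact: path_graph_pair_off_neighborhoods.
Qed.

Lemma lex_cycle_outcome_R : outcome_R (lex_product e (cycle_graph (2 * l))).
Proof.
apply: (@lex_product_outcome_R _ _ _ _ (@ord_mate l)) => //.
- by apply: cycle_graph_irr; lia.
- exact: cycle_graph_sym.
- by apply: cycle_graph_C4_free; lia.
- exact: cycle_graph_matching.
- exact: cycle_graph_pair_off_neighborhoods.
Qed.

End LexPathCycle.

Lemma all_iota_ord n (P : pred nat) : all P (iota 0 n) -> forall i : 'I_n, P i.
Proof. by move=> /allP allP i; apply: allP; rewrite mem_iota ltn_ord. Qed.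

Lemma has_iota_ord n (P : pred nat) : has P (iota 0 n) -> exists i : 'I_n, P i.
Proof.
by case/hasP=> i; rewrite mem_iota => lt_i Pi; exists (Ordinal lt_i).
Qed.

Definition P6_pairing (i : nat) : nat := nth 0 [:: 5; 3; 4; 1; 2; 0] i.

Definition P6_mate (i : 'I_6) : 'I_6 := inord (P6_pairing i).

Lemma P6_mateE i : P6_mate i = P6_pairing i :> nat.
Proof. by rewrite inordK //; case: i => [[|[|[|[|[|[|]]]]]]]. Qed.

Lemma P6_mateK : involutive P6_mate.
Proof.
move=> i; apply: val_inj; rewrite /= !P6_mateE.
by case: i => [[|[|[|[|[|[|]]]]]]].
Qed.

Lemma P6_mate_neq i : P6_mate i != i.
Proof. by rewrite -val_eqE /= P6_mateE; case: i => [[|[|[|[|[|[|]]]]]]]. Qed.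

(* [path_graph] on labels, which unlike ordinals enumerate by computation. *)
Definition consecutive (i j : nat) : bool := (i.+1 == j) || (j.+1 == i).

Lemma P6_adj_resolving_pair (a b : 'I_6) :
  adj_resolving (path_graph 6) [set a; b] -> b = P6_mate a.
Proof.
move=> res; apply/val_inj/eqP; rewrite /= P6_mateE; apply: contraT => nab.
have /all_iota_ord/(_ a)/all_iota_ord/(_ b)/implyP/(_ nab) :
    all (fun a => all (fun b => (b != P6_pairing a) ==>
      has (fun u => has (fun v => [&& u != v, ~~ adj_resolves consecutive a u v
        & ~~ adj_resolves consecutive b u v]) (iota 0 6)) (iota 0 6))
      (iota 0 6)) (iota 0 6) by vm_compute.
case/has_iota_ord=> u /has_iota_ord[v /and3P[nuv not_a not_b]].
have [z] := res u v nuv; rewrite !inE => /orP[]/eqP-> res_z.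
- by case/negP: not_a.
- by case/negP: not_b.
Qed.

Lemma P6_adj_resolving_card (A : {set 'I_6}) :
  contains_no_pair P6_mate A -> adj_resolving (path_graph 6) A -> 2 < #|A|.
Proof.
move=> A_no_pair resA; rewrite ltnNge; apply/negP => cardA.
have [a Aa _] := resA ord0 ord_max isT.
have [b Ab sAab] : exists2 b, b \in A & A \subset [set a; b].
  have [A_a|[b]] := set_0Vmem (A :\ a).
    by exists a; rewrite // setUid -setD_eq0 A_a.
  rewrite !inE => /andP[nba Ab]; exists b => //.
  suff <- : [set a; b] = A by [].
  by apply/eqP; rewrite eqEcard cards2 eq_sym nba subUset !sub1set Aa Ab.
have /P6_adj_resolving_pair ab : adj_resolving (path_graph 6) [set a; b].
  by move=> u v /resA[z /(subsetP sAab)]; exists z.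
by have := A_no_pair a Aa; rewrite -ab Ab.
Qed.

Lemma lex_P6_game_length (V : finType) (e : rel V) (w : player) :
  simple_graph e -> connected_graph e -> 1 < #|V| ->
  is_game_length (lex_product e (path_graph 6)) w (3 * #|V|).
Proof.
move=> [e_sym e_irr] e_conn V_gt1; have V_gt0 := ltnW V_gt1.
split=> [|j [s win_s]].
  have [s /winning_strategy_wins_within] :=
    @lex_path_outcome_R V e 3 e_irr V_gt0 isT w.
  rewrite card_prod card_ord (_ : uphalf _ = 3 * #|V|); last by lia.
  by exists s.
have [g _] := card_gt0P V_gt0.
apply: (pairing_wins_within_ge (g, ord0) (layer_mateK P6_mateK)
  (layer_mate_neq P6_mate_neq) _ win_s) => W.
apply: (resolving_lex_card e_irr (@path_graph_irr 6) e_sym) => [h|].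
  exact: connected_neighbor.
exact: P6_adj_resolving_card.
Qed.

Theorem theorem5p5 (V : finType) (e : rel V) (e_simple : simple_graph e)
    (e_conn : connected_graph e) (V_ge2 : 2 <= #|V|) :
  (forall l : nat, 3 <= l ->
     outcome_R (lex_product e (path_graph (2 * l))) /\
     outcome_R (lex_product e (cycle_graph (2 * l)))) /\
  R_MB_is (lex_product e (path_graph 6)) (3 * #|V|) /\
  R_MB'_is (lex_product e (path_graph 6)) (3 * #|V|).
Proof.
have [_ e_irr] := e_simple; have V_gt0 := ltnW V_ge2.
split=> [l l_ge3|]; last by split; apply: lex_P6_game_length.
by split; [apply: lex_path_outcome_R | apply: lex_cycle_outcome_R].
Qed.
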